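(* (A) For every integer $k$ with $1\le k\le 5$, the inequality $$\frac{I_k\bigl(2\sqrt{u}\,\bigr)}{u^{k/2}}\ge\biggl(\frac{u}{1-e^{-u}}\biggr)^{(k-1)}$$ holds for all $u\in(0,\infty)$, where the superscript $(k-1)$ denotes the $(k-1)$-th derivative with respect to $u$. (B) For $\beta>0$ define, for $u\in(0,\infty)$, $$G_{\beta}(u)=\frac{\beta u}{I_2\bigl(2\sqrt{\beta u}\,\bigr)}\biggl(\frac{u}{1-e^{-u}}\biggr)',$$ where the prime denotes the derivative with respect to $u$. If $\beta\ge1$, then $G_\beta$ is decreasing on $(0,\infty)$. If $0<\beta<1$, then $G_\beta$ is unimodal on $(0,\infty)$ and $\frac{1}{G_\beta(u)}$ is convex on $(0,\infty)$.
   Context: For $\nu\in\mathbb{R}$, $I_\nu$ is the modified Bessel function of the first kind, $$I_\nu(z)=\sum_{k=0}^\infty\frac{1}{k!\,\Gamma(\nu+k+1)}\Bigl(\frac z2\Bigr)^{2k+\nu}.$$ A function is called unimodal on $(0,\infty)$ if it has a unique maximum there. *)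

(* Defs.v *)
From Stdlib Require Export Reals Factorial.
From Coquelicot Require Export Coquelicot.

Open Scope R_scope.

(** Rising factorial [x (x+1) ... (x+m-1)]. *)
Fixpoint rising (x : R) (m : nat) : R :=
  match m with
  | O => 1
  | S m' => rising x m' * (x + INR m')
  end.

(** Euler's integral of the second kind; meaningful for [0 < x]. *)
Definition Gamma_int (x : R) : R :=
  RInt_gen (fun t => Rpower t (x - 1) * exp (- t))
           (at_right 0) (Rbar_locally p_infty).

(** Gamma on the whole real line, by [Gamma (x + m) = rising x m * Gamma x].
    With [m = Z.to_nat (up (- x))] one has [0 < x + m], and [m = 0] when [0 < x].
    At the poles [x = 0, -1, -2, ...] the rising factorial is [0]; since
    [/ 0 = 0], [Gamma x = 0] there, so that [/ Gamma x = 0], which is the usual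
    value of the reciprocal Gamma function. *)
Definition Gamma (x : R) : R :=
  let m := Z.to_nat (up (- x)) in
  Gamma_int (x + INR m) / rising x m.

(** Modified Bessel function of the first kind. The real power is [Rpower],
    so this is meant for [0 < z] only. *)
Definition BesselI (nu z : R) : R :=
  Series (fun k : nat =>
    / (INR (fact k) * Gamma (nu + INR k + 1))
    * Rpower (z / 2) (2 * INR k + nu)).

Definition decreasing_on_pos (f : R -> R) : Prop :=
  forall x y : R, 0 < x -> x < y -> f y < f x.

Definition convex_on_pos (f : R -> R) : Prop :=
  forall x y t : R, 0 < x -> 0 < y -> 0 <= t <= 1 ->
    f (t * x + (1 - t) * y) <= t * f x + (1 - t) * f y.

(** "Unique maximum": a global maximum, attained at exactly one point. *)
Definition unimodal_on_pos (f : R -> R) : Prop :=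
  exists! x : R, 0 < x /\ forall y : R, 0 < y -> f y <= f x.

Definition phi (u : R) : R := u / (1 - exp (- u)).

Definition G (beta u : R) : R :=
  beta * u / BesselI 2 (2 * sqrt (beta * u)) * Derive phi u.

(* Main.v *)
(** Write [b_k(u) = sum_m u^m / (m! (m+k)!)], so that [I_k(2 sqrt u) = u^(k/2) b_k(u)]
    and [b_k' = b_(k+1)]; write [phi(u) = u / (1 - exp (-u))].

    (A) For [k <= 4] a partial sum of [b_k] already dominates [phi^(k-1)]: one has
    [phi <= 1 + u/2 + u^2/12], [phi' <= 1/2 + u/6], [phi'' <= 1/6] and [phi''' < 0].
    For [k = 5] the partial sum of degree 3 suffices, but the margin is small.

    (B) Here [1 / G_beta = b_2(beta u) / phi'(u)]. Its derivative has the sign of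
    [F = beta b_3(beta u) phi' - phi'' b_2(beta u)], and
    [F' = beta^2 b_4(beta u) phi' - phi''' b_2(beta u) > 0]. As [F(0+) = (beta - 1) / 12],
    [F] is positive if [beta >= 1]; if [beta < 1] it changes sign exactly once,
    since [1 / G_beta] is unbounded. Convexity holds because [phi''' < 0] and the
    quadratic form [b_4 X^2 - 2 b_3 X Y + 2 b_2 Y^2] is nonnegative. *)

Require Import Defs.
From Stdlib Require Import Ranalysis5 Lra Lia.

(** * The entire functions [bes k] and their Taylor coefficients *)

Definition bes_coef (k m : nat) : R := / (INR (fact m) * INR (fact (m + k))).

(** Unlike I_k(2 sqrt u) / u^(k/2), this is meaningful at u = 0, where later arguments need its
    value and its continuity. *)
Definition bes (k : nat) : R -> R := PSeries (bes_coef k).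

Lemma bes_coef_pos k m : 0 < bes_coef k m.
Proof.
  apply Rinv_0_lt_compat, Rmult_lt_0_compat; apply INR_fact_lt_0.
Qed.

Lemma bes_coef_shift k m :
  bes_coef k m = INR (S m + k) * bes_coef (S k) m.
Proof.
  unfold bes_coef.
  replace (m + S k)%nat with (S (m + k)) by lia.
  replace (S m + k)%nat with (S (m + k)) by lia.
  rewrite (fact_simpl (m + k)), mult_INR.
  field; repeat split; try apply INR_fact_neq_0; apply not_0_INR; lia.
Qed.

(** The coefficient form of b_k' = b_(k+1). *)
Lemma bes_coef_succ k m :
  INR (S m) * bes_coef k (S m) = bes_coef (S k) m.
Proof.
  unfold bes_coef.
  replace (m + S k)%nat with (S m + k)%nat by lia.
  rewrite (fact_simpl m), mult_INR.
  field; repeat split; try apply INR_fact_neq_0; apply not_0_INR; lia.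
Qed.

(** Ratio test: successive coefficients have quotient 1 / ((m+1)(m+k+1)) <= 1 / (m+1). *)
Lemma CV_radius_bes_coef k : CV_radius (bes_coef k) = p_infty.
Proof.
  apply CV_radius_infinite_DAlembert.
  - intros n; apply Rgt_not_eq, bes_coef_pos.
  - apply is_lim_seq_le_le with (u := fun _ => 0) (w := fun n => / INR (S n)).
    + intros n.
      rewrite Rabs_pos_eq.
      2: { apply Rlt_le, Rdiv_lt_0_compat; apply bes_coef_pos. }
      split.
      * apply Rlt_le, Rdiv_lt_0_compat; apply bes_coef_pos.
      * assert (Hn : 0 < INR (S n)) by (apply lt_0_INR; lia).
        assert (Hk : 1 <= INR (S n + k)) by (apply (le_INR 1); lia).
        pose proof (bes_coef_pos (S k) n) as Hp.
        rewrite (bes_coef_shift k n), <- (Rmult_1_l (/ INR (S n))).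
        replace (bes_coef k (S n)) with (bes_coef (S k) n / INR (S n)).
        2: { rewrite <- (bes_coef_succ k n); field; lra. }
        replace (bes_coef (S k) n / INR (S n) / (INR (S n + k) * bes_coef (S k) n))
          with (/ INR (S n + k) * / INR (S n)) by (field; lra).
        apply Rmult_le_compat_r; [apply Rlt_le, Rinv_0_lt_compat; lra|].
        rewrite <- Rinv_1; apply Rinv_le_contravar; lra.
    + apply is_lim_seq_const.
    + apply (is_lim_seq_incr_1 (fun n => / INR n)).
      replace (Finite 0) with (Rbar_inv p_infty) by reflexivity.
      apply is_lim_seq_inv; [apply is_lim_seq_INR | discriminate].
Qed.

Lemma ex_series_bes k u : ex_series (fun m => bes_coef k m * u ^ m).
Proof.
  apply ex_pseries_R, CV_radius_inside.
  rewrite CV_radius_bes_coef; exact I.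
Qed.

Lemma is_derive_bes k u : is_derive (bes k) u (bes (S k) u).
Proof.
  unfold bes.
  rewrite (PSeries_ext (bes_coef (S k)) (PS_derive (bes_coef k))).
  - apply is_derive_PSeries; rewrite CV_radius_bes_coef; exact I.
  - intros m; unfold PS_derive; now rewrite bes_coef_succ.
Qed.

Lemma Series_ge_partial_sum (a : nat -> R) (n : nat) :
  (forall m, 0 <= a m) -> ex_series a -> sum_f_R0 a n <= Series a.
Proof.
  intros Ha Hex.
  rewrite <- sum_n_Reals.
  apply (is_lim_seq_incr_compare (sum_n a) (Series a)).
  - exact (Series_correct a Hex).
  - intros m; rewrite sum_Sn; unfold plus; simpl.
    specialize (Ha (S m)); lra.
Qed.

Lemma bes_ge_partial_sum k n u : 0 <= u ->
  sum_f_R0 (fun m => bes_coef k m * u ^ m) n <= bes k u.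
Proof.
  intros Hu; apply Series_ge_partial_sum; [|apply ex_series_bes].
  intros m; apply Rmult_le_pos; [apply Rlt_le, bes_coef_pos | now apply pow_le].
Qed.

Lemma bes_ge_0th k u : 0 <= u -> / INR (fact k) <= bes k u.
Proof.
  intros Hu; pose proof (bes_ge_partial_sum k 0 u Hu) as H.
  cbn -[fact INR Nat.add] in H; unfold bes_coef in H.
  rewrite Nat.add_0_l in H; simpl (INR (fact 0)) in H.
  now rewrite Rmult_1_l, Rmult_1_r in H.
Qed.

Lemma bes_pos k u : 0 <= u -> 0 < bes k u.
Proof.
  intros Hu; apply Rlt_le_trans with (2 := bes_ge_0th k u Hu).
  apply Rinv_0_lt_compat, INR_fact_lt_0.
Qed.

Lemma bes_at_0 k : bes k 0 = / INR (fact k).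
Proof.
  unfold bes; rewrite PSeries_0; unfold bes_coef; simpl (0 + k)%nat.
  simpl (INR (fact 0)); now rewrite Rmult_1_l.
Qed.

(* A termwise discriminant bound: the coefficients satisfy
   [c3^2 / (c2 c4) = (m+4)/(m+3) < 2]. *)
Lemma bes_quadratic_form_nonneg u X Y : 0 <= u ->
  0 <= bes 4 u * X ^ 2 - 2 * bes 3 u * X * Y + 2 * bes 2 u * Y ^ 2.
Proof.
  intros Hu.
  replace (bes 4 u * X ^ 2 - 2 * bes 3 u * X * Y + 2 * bes 2 u * Y ^ 2)
    with (Series (fun m => X ^ 2 * (bes_coef 4 m * u ^ m)
      + ((- 2 * X * Y) * (bes_coef 3 m * u ^ m)
         + (2 * Y ^ 2) * (bes_coef 2 m * u ^ m)))).
  - pose proof (Series_ge_partial_sum (fun m => X ^ 2 * (bes_coef 4 m * u ^ m)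
      + ((- 2 * X * Y) * (bes_coef 3 m * u ^ m)
         + (2 * Y ^ 2) * (bes_coef 2 m * u ^ m))) 0) as H.
    assert (Ht : forall m, 0 <= X ^ 2 * (bes_coef 4 m * u ^ m)
      + ((- 2 * X * Y) * (bes_coef 3 m * u ^ m)
         + (2 * Y ^ 2) * (bes_coef 2 m * u ^ m))).
    { intros m.
      rewrite (bes_coef_shift 2 m), (bes_coef_shift 3 m).
      set (c := bes_coef 4 m).
      assert (0 < c) by apply bes_coef_pos.
      assert (0 <= u ^ m) by now apply pow_le.
      assert (H3 : 3 <= INR (S m + 2)).
      { replace 3 with (INR 3) by (simpl; ring); apply le_INR; lia. }
      replace (S m + 3)%nat with (S (S m + 2)) by lia.
      rewrite (S_INR (S m + 2)).
      set (r := INR (S m + 2)) in *.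
      (* Here r = m + 3, c3 = (r+1) c4 and c2 = r (r+1) c4. Completing the square in X leaves 2 r
         (r+1) - (r+1)^2 = (r+1)(r-1) as coefficient of Y^2. *)
      replace (_ + _) with
        (c * u ^ m * ((X - (r + 1) * Y) ^ 2 + (r + 1) * (r - 1) * Y ^ 2)) by ring.
      apply Rmult_le_pos; [apply Rmult_le_pos; lra|].
      apply Rplus_le_le_0_compat; [apply pow2_ge_0|].
      apply Rmult_le_pos; [nra | apply pow2_ge_0]. }
    apply Rle_trans with (2 := H Ht ltac:(
      repeat apply (@ex_series_plus R_AbsRing R_NormedModule);
      apply (@ex_series_scal_l R_AbsRing); apply ex_series_bes)).
    simpl sum_f_R0; apply Ht.
  - rewrite !Series_plus, !Series_scal_l;
      try (repeat apply (@ex_series_plus R_AbsRing R_NormedModule);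
           apply (@ex_series_scal_l R_AbsRing); apply ex_series_bes).
    unfold bes, PSeries; ring.
Qed.

(** * Gamma at positive integers and the Bessel series *)

(* [t^n exp(-t)] has the antiderivative [- gamma_poly n t * exp(-t)]. *)
Fixpoint gamma_poly (n : nat) (t : R) : R :=
  match n with
  | O => 1
  | S n' => t ^ S n' + INR (S n') * gamma_poly n' t
  end.

Lemma is_derive_gamma_poly n t :
  is_derive (gamma_poly n) t (gamma_poly n t - t ^ n).
Proof.
  induction n as [|n IH].
  - simpl; apply (is_derive_ext (fun _ => 1)); [easy|].
    replace (1 - 1) with 0 by ring; apply @is_derive_const.
  - change (gamma_poly (S n)) with
      (fun t => t ^ S n + INR (S n) * gamma_poly n t).
    auto_derive.
    + now exists (gamma_poly n t - t ^ n).
    + replace (Derive _ t) with (gamma_poly n t - t ^ n)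
        by (symmetry; apply is_derive_unique, IH).
      change (match n with 0%nat => 1 | S _ => INR n + 1 end) with (INR (S n)).
      simpl pow; ring.
Qed.

Lemma gamma_poly_0 n : gamma_poly n 0 = INR (fact n).
Proof.
  induction n as [|n IH]; [easy|].
  change (gamma_poly (S n) 0) with (0 ^ S n + INR (S n) * gamma_poly n 0).
  rewrite IH, pow_i, fact_simpl, mult_INR by lia; ring.
Qed.

(** The Taylor bound exp t >= t^(n+1) / (n+1)! keeps the product below (n+1)! / t for t > 0. *)
Lemma is_lim_pow_mult_exp_opp n : is_lim (fun t => t ^ n * exp (- t)) p_infty 0.
Proof.
  apply is_lim_le_le_loc with (f := fun _ => 0)
    (g := fun t => INR (fact (S n)) * / t).
  - exists 0; intros t Ht.
    assert (Hn : 0 < t ^ n) by now apply pow_lt.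
    assert (He : t ^ S n / INR (fact (S n)) <= exp t).
    { apply Rle_trans with (2 := exp_ge_taylor t (S n) (Rlt_le _ _ Ht)).
      rewrite tech5.
      assert (0 <= sum_f_R0 (fun k => t ^ k / INR (fact k)) n); [|lra].
      apply cond_pos_sum; intros m.
      apply Rdiv_le_0_compat; [apply pow_le; lra | apply INR_fact_lt_0]. }
    rewrite exp_Ropp.
    pose proof (exp_pos t) as Hep; pose proof (INR_fact_lt_0 (S n)) as Hf.
    split.
    + apply Rlt_le, Rmult_lt_0_compat; [easy | now apply Rinv_0_lt_compat].
    + apply Rmult_le_reg_r with (exp t * t); [nra|].
      replace (t ^ n * / exp t * (exp t * t)) with (t ^ S n)
        by (simpl; field; lra).
      replace (INR (fact (S n)) * / t * (exp t * t))
        with (INR (fact (S n)) * exp t) by (field; lra).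
      apply Rmult_le_compat_l with (r := INR (fact (S n))) in He; [|lra].
      replace (INR (fact (S n)) * (t ^ S n / INR (fact (S n))))
        with (t ^ S n) in He by (field; lra).
      exact He.
  - apply is_lim_const.
  - replace (Finite 0) with (Rbar_mult (INR (fact (S n))) (Rbar_inv p_infty))
      by (simpl; f_equal; ring).
    apply is_lim_scal_l, is_lim_inv; [apply is_lim_id | discriminate].
Qed.

Lemma is_lim_gamma_poly_mult_exp_opp n :
  is_lim (fun t => gamma_poly n t * exp (- t)) p_infty 0.
Proof.
  induction n as [|n IH].
  - apply (is_lim_ext (fun t => t ^ 0 * exp (- t)));
      [easy | apply is_lim_pow_mult_exp_opp].
  - apply (is_lim_ext (fun t => t ^ S n * exp (- t)
      + INR (S n) * (gamma_poly n t * exp (- t)))).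
    + intros t.
      change (gamma_poly (S n) t) with (t ^ S n + INR (S n) * gamma_poly n t); ring.
    + apply (is_lim_plus _ _ _ 0 0); [apply is_lim_pow_mult_exp_opp | |].
      * replace (Finite 0) with (Rbar_mult (INR (S n)) 0)
          by (unfold Rbar_mult; simpl; f_equal; ring).
        apply is_lim_scal_l, IH.
      * unfold is_Rbar_plus; simpl; do 2 f_equal; ring.
Qed.

(** Fundamental theorem of calculus with the antiderivative [F]: its value at 0 is - n!, and it
    vanishes at infinity. *)
Lemma Gamma_int_succ n : Gamma_int (INR n + 1) = INR (fact n).
Proof.
  set (F := fun t => - (gamma_poly n t * exp (- t))).
  assert (HF : forall t, is_derive F t (t ^ n * exp (- t))).
  { intros t; unfold F; auto_derive.
    - exists (gamma_poly n t - t ^ n); apply is_derive_gamma_poly.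
    - replace (Derive _ t) with (gamma_poly n t - t ^ n)
        by (symmetry; apply is_derive_unique, is_derive_gamma_poly).
      ring. }
  assert (HF0 : F 0 = - INR (fact n)).
  { unfold F; rewrite gamma_poly_0, Ropp_0, exp_0; ring. }
  unfold Gamma_int; apply is_RInt_gen_unique.
  apply is_RInt_gen_ext with (f := Derive F).
  (* [Rpower] is identified with the integer power only for positive t, so both endpoints are taken
     positive. *)
  - exists (fun x => 0 < x) (fun y => 0 < y).
    + now exists (mkposreal 1 Rlt_0_1).
    + now exists 0.
    + intros x y Hx Hy t [Ht _]; simpl in Ht.
      assert (0 < t) by (apply Rlt_trans with (2 := Ht), Rmin_glb_lt; easy).
      rewrite (is_derive_unique _ _ _ (HF t)).
      f_equal; replace (INR n + 1 - 1) with (INR n) by ring.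
      now rewrite Rpower_pow.
  - replace (INR (fact n)) with (0 - F 0) by (rewrite HF0; ring).
    assert (HD : forall t, Derive F t = t ^ n * exp (- t))
      by (intros t; apply is_derive_unique, HF).
    apply is_RInt_gen_Derive.
    + apply filter_forall; intros ab x _; now exists (x ^ n * exp (- x)).
    + apply filter_forall; intros ab x _.
      apply continuous_ext with (f := fun t => t ^ n * exp (- t)); [easy|].
      apply @ex_derive_continuous; auto_derive; easy.
    + assert (Hc : continuous F 0)
        by (apply @ex_derive_continuous; now exists (0 ^ n * exp (- 0))).
      intros P HP; destruct (Hc P HP) as [d Hd]; exists d; intros x Hx _; exact (Hd x Hx).
    + assert (H := is_lim_opp _ _ _ (is_lim_gamma_poly_mult_exp_opp n)).
      simpl Rbar_opp in H; rewrite Ropp_0 in H; exact H.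
Qed.

Lemma Gamma_succ n : Gamma (INR n + 1) = INR (fact n).
Proof.
  unfold Gamma.
  (* [up] is the least integer strictly above its argument, here -n, which [Z.to_nat] sends to 0: no
     shift takes place. *)
  replace (Z.to_nat (up (- (INR n + 1)))) with O.
  - simpl rising; simpl (INR 0).
    rewrite Rplus_0_r, Gamma_int_succ; field.
  - rewrite INR_IZR_INZ, <- plus_IZR, <- opp_IZR.
    replace (up _) with (- (Z.of_nat n + 1) + 1)%Z; [lia|].
    apply tech_up; rewrite plus_IZR; lra.
Qed.

Lemma BesselI_nat k u : 0 < u ->
  BesselI (INR k) (2 * sqrt u) = Rpower u (INR k / 2) * bes k u.
Proof.
  intros Hu; unfold BesselI, bes, PSeries.
  rewrite <- Series_scal_l; apply Series_ext; intros m.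
  replace (INR k + INR m + 1) with (INR (m + k) + 1) by (rewrite plus_INR; ring).
  rewrite Gamma_succ.
  replace (2 * sqrt u / 2) with (Rpower u (/ 2)) by (rewrite Rpower_sqrt by lra; field).
  rewrite Rpower_mult.
  replace (/ 2 * (2 * INR m + INR k)) with (INR m + INR k / 2) by field.
  rewrite Rpower_plus, Rpower_pow by lra.
  unfold bes_coef; ring.
Qed.

(** * Elementary inequalities for the exponential *)

Lemma increment_as_derivative (f f' : R -> R) (a b : R) : a < b ->
  (forall x, a <= x <= b -> is_derive f x (f' x)) ->
  exists c, a < c < b /\ f b - f a = f' c * (b - a).
Proof.
  intros Hab Hd.
  destruct (MVT_cor2 f f' a b Hab) as [c [H1 H2]].
  - intros c Hc; apply is_derive_Reals, Hd, Hc.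
  - now exists c.
Qed.

(** Applied repeatedly below: an expression vanishing at 0 is differentiated until the derivative is
    visibly positive. *)
Lemma pos_of_derive_pos (f f' : R -> R) :
  (forall x, is_derive f x (f' x)) -> 0 <= f 0 ->
  (forall x, 0 < x -> 0 < f' x) -> forall x, 0 < x -> 0 < f x.
Proof.
  intros Hd H0 Hp x Hx.
  destruct (increment_as_derivative f f' 0 x Hx) as [c [Hc E]].
  - intros; apply Hd.
  - assert (0 < f' c * (x - 0)) by (apply Rmult_lt_0_compat; [apply Hp|]; lra).
    lra.
Qed.

Ltac derive_by_ring := intros x; auto_derive; [easy | ring].

Lemma exp_gt_one u : 0 < u -> 1 < exp u.
Proof. intros H; rewrite <- exp_0; now apply exp_increasing. Qed.

Lemma exp_pred_lt u : 0 < u -> exp u - 1 < u * exp u.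
Proof.
  intros Hu.
  cut (0 < u * exp u - (exp u - 1)); [lra|].
  revert u Hu.
  apply pos_of_derive_pos with (f' := fun u => u * exp u).
  - derive_by_ring.
  - rewrite exp_0; lra.
  - intros u Hu; pose proof (exp_pos u); nra.
Qed.

(** Division by 2 exp u turns this into u < sinh u. *)
Lemma exp_sq_gt u : 0 < u -> 2 * u * exp u < exp u ^ 2 - 1.
Proof.
  intros Hu.
  cut (0 < exp u ^ 2 - 1 - 2 * u * exp u); [lra|].
  revert u Hu.
  apply pos_of_derive_pos with (f' := fun u => 2 * exp u * (exp u - 1 - u)).
  - derive_by_ring.
  - rewrite exp_0; lra.
  - intros u Hu; apply Rmult_lt_0_compat.
    + pose proof (exp_pos u); lra.
    + pose proof (exp_ineq1 u ltac:(lra)); lra.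
Qed.

(** The right side is twice the error of the trapezoidal rule for exp on [0, u], and that error
    exceeds u^3 / 12 because exp'' > 1 on (0, u). *)
Lemma exp_trapezoid u : 0 < u -> u ^ 3 / 6 < u * (exp u + 1) - 2 * (exp u - 1).
Proof.
  intros Hu.
  cut (0 < u * (exp u + 1) - 2 * (exp u - 1) - u ^ 3 / 6); [lra|].
  revert u Hu.
  apply pos_of_derive_pos with (f' := fun u => u * exp u - exp u + 1 - u ^ 2 / 2).
  - intros x; auto_derive; [easy | field].
  - rewrite exp_0; lra.
  - apply pos_of_derive_pos with (f' := fun u => u * (exp u - 1)).
    + intros x; auto_derive; [easy | field].
    + rewrite exp_0; lra.
    + intros u Hu; pose proof (exp_gt_one u Hu); nra.
Qed.

(* Divided by [exp u], this is [3 sinh u < u (cosh u + 2)]. *)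
Lemma cusa_huygens_exp u : 0 < u ->
  3 * (exp u ^ 2 - 1) < u * (exp u ^ 2 + 4 * exp u + 1).
Proof.
  intros Hu.
  cut (0 < u * (exp u ^ 2 + 4 * exp u + 1) - 3 * (exp u ^ 2 - 1)); [lra|].
  revert u Hu.
  apply pos_of_derive_pos with
    (f' := fun u => - 5 * exp u ^ 2 + 4 * exp u + 1 + u * (2 * exp u ^ 2 + 4 * exp u)).
  - derive_by_ring.
  - rewrite exp_0; lra.
  - apply pos_of_derive_pos with
      (f' := fun u => 4 * exp u * (u * (exp u + 1) - 2 * (exp u - 1))).
    + derive_by_ring.
    + rewrite exp_0; lra.
    + intros u Hu; apply Rmult_lt_0_compat.
      * pose proof (exp_pos u); lra.
      * pose proof (exp_trapezoid u Hu); pose proof (pow_lt u 3 Hu); lra.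
Qed.

(** The bound phi'' < 1/6 with denominators cleared. *)
Lemma exp_pred_cube_gt u : 0 < u ->
  6 * exp u * (u * (exp u + 1) - 2 * (exp u - 1)) < (exp u - 1) ^ 3.
Proof.
  intros Hu.
  cut (0 < (exp u - 1) ^ 3 - 6 * exp u * (u * (exp u + 1) - 2 * (exp u - 1))); [lra|].
  revert u Hu.
  apply pos_of_derive_pos with
    (f' := fun u => 3 * exp u *
      (exp u ^ 2 + 4 * exp u - 5 - 4 * u * exp u - 2 * u)).
  - derive_by_ring.
  - rewrite exp_0; lra.
  - intros u Hu; apply Rmult_lt_0_compat; [pose proof (exp_pos u); lra|].
    revert u Hu.
    apply pos_of_derive_pos with (f' := fun u => 2 * (exp u ^ 2 - 1 - 2 * u * exp u)).
    + derive_by_ring.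
    + rewrite exp_0; lra.
    + intros u Hu; pose proof (exp_sq_gt u Hu); lra.
Qed.

(** Equivalently, exp u exceeds its Pade approximant (12 + 6u + u^2) / (12 - 6u + u^2). This form is
    the quadratic bound on phi with denominators cleared. *)
Lemma exp_pade_gt u : 0 < u -> 12 * u * exp u < (exp u - 1) * (12 + 6 * u + u ^ 2).
Proof.
  intros Hu.
  cut (0 < (exp u - 1) * (12 + 6 * u + u ^ 2) - 12 * u * exp u); [lra|].
  revert u Hu.
  apply pos_of_derive_pos with
    (f' := fun u => exp u * (u ^ 2 - 4 * u + 6) - 6 - 2 * u).
  - derive_by_ring.
  - rewrite exp_0; lra.
  - apply pos_of_derive_pos with (f' := fun u => exp u * (u ^ 2 - 2 * u + 2) - 2).
    + derive_by_ring.
    + rewrite exp_0; lra.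
    + apply pos_of_derive_pos with (f' := fun u => exp u * u ^ 2).
      * derive_by_ring.
      * rewrite exp_0; lra.
      * intros u Hu; apply Rmult_lt_0_compat; [apply exp_pos | now apply pow_lt].
Qed.

(** * Closed forms and bounds for the derivatives of [phi] *)

(** [phi1] to [phi4] are the derivatives of [phi] for u > 0 only. At 0 division by zero makes [phi1]
    and [phi2] equal to 0 instead of their limits 1/2 and 1/6, so behaviour near 0 has to come from
    inequalities. *)
Definition phi1 (u : R) : R :=
  (exp u ^ 2 - exp u - u * exp u) / (exp u - 1) ^ 2.

Definition phi2 (u : R) : R :=
  exp u * (u * (exp u + 1) - 2 * (exp u - 1)) / (exp u - 1) ^ 3.

Definition phi3 (u : R) : R :=
  exp u * (3 * (exp u ^ 2 - 1) - u * (exp u ^ 2 + 4 * exp u + 1)) / (exp u - 1) ^ 4.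

Definition phi4 (u : R) : R :=
  exp u * (u * (exp u ^ 3 + 11 * exp u ^ 2 + 11 * exp u + 1)
    - 4 * (exp u - 1) * (exp u ^ 2 + 4 * exp u + 1)) / (exp u - 1) ^ 5.

Ltac derive_phi u Hu :=
  pose proof (exp_gt_one u Hu); pose proof (exp_pos u);
  auto_derive;
  [ repeat split; repeat apply Rmult_integral_contrapositive_currified; lra
  | field; lra ].

Lemma phi_exp u : 0 < u -> phi u = u * exp u / (exp u - 1).
Proof.
  intros Hu; pose proof (exp_gt_one u Hu).
  unfold phi; rewrite exp_Ropp; field; lra.
Qed.

Lemma is_derive_phi u : 0 < u -> is_derive phi u (phi1 u).
Proof.
  intros Hu.
  apply is_derive_ext_loc with (f := fun u => u * exp u / (exp u - 1)).
  - exists (mkposreal u Hu); intros v Hv.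
    symmetry; apply phi_exp.
    unfold ball in Hv; simpl in Hv; unfold AbsRing_ball, abs, minus, plus, opp in Hv.
    simpl in Hv; apply Rabs_def2 in Hv; lra.
  - unfold phi1; derive_phi u Hu.
Qed.

Lemma is_derive_phi1 u : 0 < u -> is_derive phi1 u (phi2 u).
Proof. intros Hu; unfold phi1, phi2; derive_phi u Hu. Qed.

Lemma is_derive_phi2 u : 0 < u -> is_derive phi2 u (phi3 u).
Proof. intros Hu; unfold phi2, phi3; derive_phi u Hu. Qed.

Lemma is_derive_phi3 u : 0 < u -> is_derive phi3 u (phi4 u).
Proof. intros Hu; unfold phi3, phi4; derive_phi u Hu. Qed.

(** Since (0, infinity) is open, agreement of the n-th derivative with g there allows g to be
    differentiated in its place. *)
Lemma Derive_n_succ_pos (f g h : R -> R) n :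
  (forall u, 0 < u -> Derive_n f n u = g u) ->
  (forall u, 0 < u -> is_derive g u (h u)) ->
  forall u, 0 < u -> Derive_n f (S n) u = h u.
Proof.
  intros Hf Hg u Hu; simpl.
  apply is_derive_unique, is_derive_ext_loc with (f := g); [|now apply Hg].
  exists (mkposreal u Hu); intros v Hv; symmetry; apply Hf.
  unfold ball in Hv; simpl in Hv; unfold AbsRing_ball, abs, minus, plus, opp in Hv.
  simpl in Hv; apply Rabs_def2 in Hv; lra.
Qed.

Lemma Derive_n_phi_1 u : 0 < u -> Derive_n phi 1 u = phi1 u.
Proof.
  revert u; apply Derive_n_succ_pos with (g := phi); [easy | exact is_derive_phi].
Qed.

Lemma Derive_n_phi_2 u : 0 < u -> Derive_n phi 2 u = phi2 u.
Proof. revert u; exact (Derive_n_succ_pos _ _ _ _ Derive_n_phi_1 is_derive_phi1). Qed.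

Lemma Derive_n_phi_3 u : 0 < u -> Derive_n phi 3 u = phi3 u.
Proof. revert u; exact (Derive_n_succ_pos _ _ _ _ Derive_n_phi_2 is_derive_phi2). Qed.

Lemma Derive_n_phi_4 u : 0 < u -> Derive_n phi 4 u = phi4 u.
Proof. revert u; exact (Derive_n_succ_pos _ _ _ _ Derive_n_phi_3 is_derive_phi3). Qed.

Lemma phi_lt u : 0 < u -> phi u < 1 + u / 2 + u ^ 2 / 12.
Proof.
  intros Hu; rewrite phi_exp by easy.
  pose proof (exp_gt_one u Hu); pose proof (exp_pade_gt u Hu).
  apply Rlt_div_l; lra.
Qed.

Lemma phi1_gt u : 0 < u -> 1 / 2 < phi1 u.
Proof.
  intros Hu; unfold phi1.
  pose proof (exp_gt_one u Hu); pose proof (exp_sq_gt u Hu).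
  apply -> Rlt_div_r; [lra | apply pow_lt; lra].
Qed.

Lemma phi1_lt_1 u : 0 < u -> phi1 u < 1.
Proof.
  intros Hu; unfold phi1.
  pose proof (exp_gt_one u Hu); pose proof (exp_pred_lt u Hu).
  apply Rlt_div_l; [apply pow_lt|]; lra.
Qed.

(** Clearing the denominator gives [cusa_huygens_exp], the same inequality that makes [phi3]
    negative. *)
Lemma phi1_lt_affine u : 0 < u -> phi1 u < 1 / 2 + u / 6.
Proof.
  intros Hu; unfold phi1.
  pose proof (exp_gt_one u Hu); pose proof (cusa_huygens_exp u Hu).
  apply Rlt_div_l; [apply pow_lt|]; lra.
Qed.

Lemma phi2_lt u : 0 < u -> phi2 u < 1 / 6.
Proof.
  intros Hu; unfold phi2.
  pose proof (exp_gt_one u Hu); pose proof (exp_pred_cube_gt u Hu).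
  apply Rlt_div_l; [apply pow_lt|]; lra.
Qed.

(** A lower bound that is continuous at 0 with the correct value 1/6. The numerator exceeds exp u *
    u^3 / 6 and the denominator is below (u exp u)^3. *)
Lemma phi2_gt u : 0 < u -> / (6 * exp u ^ 2) < phi2 u.
Proof.
  intros Hu; unfold phi2.
  pose proof (exp_gt_one u Hu) as He; pose proof (exp_trapezoid u Hu) as H1.
  assert (H2 : (exp u - 1) ^ 3 < (u * exp u) ^ 3).
  { pose proof (exp_pred_lt u Hu).
    set (a := exp u - 1) in *; set (b := u * exp u) in *.
    assert (0 < (b - a) * (a ^ 2 + a * b + b ^ 2))
      by (apply Rmult_lt_0_compat; unfold a in *; nra).
    lra. }
  apply -> Rlt_div_r; [|apply pow_lt; lra].
  apply Rmult_lt_reg_l with (6 * exp u ^ 2); [nra|].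
  rewrite <- Rmult_assoc, Rinv_r, Rmult_1_l by nra.
  apply Rlt_trans with (1 := H2).
  replace ((u * exp u) ^ 3) with (6 * exp u ^ 3 * (u ^ 3 / 6)) by field.
  replace (6 * exp u ^ 2 * (exp u * (u * (exp u + 1) - 2 * (exp u - 1))))
    with (6 * exp u ^ 3 * (u * (exp u + 1) - 2 * (exp u - 1))) by ring.
  apply Rmult_lt_compat_l; [pose proof (pow_lt (exp u) 3); lra | easy].
Qed.

Lemma phi3_neg u : 0 < u -> phi3 u < 0.
Proof.
  intros Hu; unfold phi3.
  pose proof (exp_gt_one u Hu); pose proof (cusa_huygens_exp u Hu).
  apply Rlt_div_l; [apply pow_lt; lra|]. nra.
Qed.

(** * The fourth derivative of [phi] against [bes 5] *)

(* With [u = 2 v], the bound [phi4 u <= bes 5 u] follows from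
   [v * cosh v * (sinh v ^ 2 + 3) <= q * sinh v ^ 5 + 2 * sinh v ^ 3 + 3 * sinh v],
   where [q / 2] is the cubic Taylor polynomial of [bes 5 (2 v)] at [0].
   Dividing by the factor of [v] and differentiating removes the explicit [v],
   which then survives only through [q]. *)
Definition quintic_weight (v : R) : R := 1 / 60 + v / 180 + v ^ 2 / 1260 + v ^ 3 / 15120.
Definition quintic_weight' (v : R) : R := 1 / 180 + v / 630 + v ^ 2 / 5040.

Definition arc_bound (v : R) : R :=
  (quintic_weight v * sinh v ^ 5 + 2 * sinh v ^ 3 + 3 * sinh v)
    / (cosh v * (sinh v ^ 2 + 3)).

(** What remains of the derivative of [arc_bound v - v] once a nonnegative factor containing sinh^4
    is split off; only its sign matters. *)
Definition arc_bound_slope (v : R) : R :=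
  let y := sinh v ^ 2 in
  1 - y + quintic_weight v * (2 * y ^ 2 + 15 * y + 15)
    + quintic_weight' v * (sinh v * cosh v) * (y + 3).

Lemma cosh_sq v : cosh v ^ 2 = 1 + sinh v ^ 2.
Proof.
  unfold cosh, sinh; rewrite exp_Ropp; field.
  apply Rgt_not_eq, exp_pos.
Qed.

Lemma cosh_pos v : 0 < cosh v.
Proof. unfold cosh; pose proof (exp_pos v); pose proof (exp_pos (- v)); lra. Qed.

Lemma sinh_pos v : 0 < v -> 0 < sinh v.
Proof. intros Hv; unfold sinh; assert (exp (- v) < exp v) by (apply exp_increasing; lra); lra. Qed.

Lemma is_derive_arc_bound v :
  is_derive (fun v => arc_bound v - v) v
    (sinh v ^ 4 * arc_bound_slope v / (cosh v * (sinh v ^ 2 + 3)) ^ 2).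
Proof.
  assert (Hs : is_derive sinh v (cosh v))
    by apply is_derive_Reals, derivable_pt_lim_sinh.
  assert (Hc : is_derive cosh v (sinh v))
    by apply is_derive_Reals, derivable_pt_lim_cosh.
  pose proof (cosh_pos v); pose proof (pow2_ge_0 (sinh v)).
  unfold arc_bound, quintic_weight; auto_derive.
  - repeat split; try (eexists; eassumption).
    apply Rmult_integral_contrapositive_currified; simpl in *; lra.
  - replace (Derive (fun x => sinh x) v) with (cosh v)
      by (symmetry; exact (is_derive_unique _ _ _ Hs)).
    replace (Derive (fun x => cosh x) v) with (sinh v)
      by (symmetry; exact (is_derive_unique _ _ _ Hc)).
    unfold arc_bound_slope, quintic_weight, quintic_weight'.
    pose proof (cosh_sq v) as E; simpl pow in E |- *; rewrite !Rmult_1_r in *.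
    field [E]; split; nra.
Qed.

Lemma sinh_gt_id v : 0 < v -> v < sinh v.
Proof.
  intros Hv; pose proof (exp_sq_gt v Hv); pose proof (exp_pos v).
  unfold sinh; rewrite exp_Ropp.
  apply Rmult_lt_reg_r with (2 * exp v); [lra|].
  replace ((exp v - / exp v) / 2 * (2 * exp v)) with (exp v ^ 2 - 1) by (field; lra).
  lra.
Qed.

(* [exp (1/100) <= 100/99] because [exp (-1/100) >= 99/100]. *)
Lemma exp_le_pow_centesimal n v : v <= INR n / 100 -> exp v <= (100 / 99) ^ n.
Proof.
  intros Hv.
  assert (H1 : exp (1 / 100) <= 100 / 99).
  { pose proof (exp_ineq1_le (- (1 / 100))) as H; pose proof (exp_pos (1 / 100)).
    rewrite exp_Ropp in H.
    apply Rmult_le_reg_r with (/ exp (1 / 100)); [now apply Rinv_0_lt_compat|].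
    rewrite Rinv_r by lra; lra. }
  apply Rle_trans with (exp (1 / 100) ^ n).
  - rewrite <- Rpower_pow by apply exp_pos.
    unfold Rpower; rewrite ln_exp.
    destruct (Req_dec v (INR n * (1 / 100))) as [->|Hne]; [lra|].
    apply Rlt_le, exp_increasing; lra.
  - apply pow_incr; split; [apply Rlt_le, exp_pos | exact H1].
Qed.

(** (E - 1/E) / 2 increases with E = exp v, so a rational upper bound on exp v yields one on sinh
    v. *)
Lemma sinh_le_centesimal n v U :
  v <= INR n / 100 -> (100 / 99) ^ n <= U -> sinh v <= (U - / U) / 2.
Proof.
  intros Hv HU; pose proof (exp_le_pow_centesimal n v Hv) as H.
  pose proof (exp_pos v) as Hp.
  unfold sinh; rewrite exp_Ropp.
  assert (/ U <= / exp v) by (apply Rinv_le_contravar; lra).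
  lra.
Qed.

Lemma quadratic_nonneg a b c y : 0 < a -> b ^ 2 <= 4 * a * c ->
  0 <= c + b * y + a * y ^ 2.
Proof.
  intros Ha Hd.
  apply Rmult_le_reg_l with (4 * a); [lra|].
  replace (4 * a * (c + b * y + a * y ^ 2))
    with ((2 * a * y + b) ^ 2 + (4 * a * c - b ^ 2)) by ring.
  pose proof (pow2_ge_0 (2 * a * y + b)); lra.
Qed.

Lemma quintic_weight_incr v w : 0 <= v <= w ->
  0 <= quintic_weight v <= quintic_weight w /\
  0 <= quintic_weight' v <= quintic_weight' w.
Proof.
  intros [Hv Hw]; unfold quintic_weight, quintic_weight'.
  pose proof (pow_incr v w 2 (conj Hv Hw)); pose proof (pow_incr v w 3 (conj Hv Hw)).
  pose proof (pow_le v 2 Hv); pose proof (pow_le v 3 Hv); lra.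
Qed.

(* [sinh v cosh v = sqrt (y (y + 1)) >= y + 2/5] as soon as [y >= 4/5]. *)
Lemma arc_bound_slope_ge v0 v : 1 <= v0 <= v ->
  let y := sinh v ^ 2 in
  1 - y + quintic_weight v0 * (2 * y ^ 2 + 15 * y + 15)
    + quintic_weight' v0 * (y + 2 / 5) * (y + 3) <= arc_bound_slope v.
Proof.
  intros Hv y.
  destruct (quintic_weight_incr v0 v ltac:(lra)) as [[Hq Hq1] [Hr Hr1]].
  assert (Hs : v < sinh v) by (apply sinh_gt_id; lra).
  assert (Hy : 1 <= y) by (unfold y; nra).
  assert (Hsc : y + 2 / 5 <= sinh v * cosh v).
  { pose proof (cosh_pos v); pose proof (cosh_sq v).
    apply Rsqr_incr_0; [|lra|apply Rmult_le_pos; lra].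
    unfold Rsqr.
    replace (sinh v * cosh v * (sinh v * cosh v)) with (y * cosh v ^ 2)
      by (unfold y; ring).
    rewrite H0; fold y; lra. }
  unfold arc_bound_slope; fold y.
  apply Rplus_le_compat; [apply Rplus_le_compat_l, Rmult_le_compat_r; nra|].
  apply Rmult_le_compat_r; [lra|].
  apply Rmult_le_compat; lra.
Qed.

(** For v <= 1.1 the weight is bounded below by its value at 0. On [1.1, 1.3], [1.3, 1.4] and beyond
    1.4, both weights are frozen at the left end, which leaves a quadratic in y = sinh^2 v. *)
Lemma arc_bound_slope_nonneg v : 0 < v -> 0 <= arc_bound_slope v.
Proof.
  intros Hv.
  pose proof (sinh_pos v Hv) as Hs.
  set (y := sinh v ^ 2).
  assert (Hy : 0 <= y) by apply pow2_ge_0.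
  destruct (Rle_dec v (11 / 10)) as [H1|H1].
  (* The constants 3.021, 3.694 and 4.084 are (100/99)^n rounded up, for n = 110, 130, 140. *)
  { assert (Hb : sinh v <= (3.021 - / 3.021) / 2)
      by (apply (sinh_le_centesimal 110); [simpl; lra | lra]).
    (* 1.81 lies just below the smaller root, about 1.813, of 5/4 - 3y/4 + y^2/30. *)
    assert (Hyb : y <= 1.81) by (unfold y; nra).
    unfold arc_bound_slope; fold y.
    destruct (quintic_weight_incr 0 v ltac:(lra)) as [[_ Hq] [Hr0 Hr]].
    unfold quintic_weight at 1 in Hq.
    pose proof (cosh_pos v).
    assert (0 <= quintic_weight' v * (sinh v * cosh v) * (y + 3))
      by (apply Rmult_le_pos; [apply Rmult_le_pos; [|apply Rmult_le_pos]|]; lra).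
    assert ((1 / 60) * (2 * y ^ 2 + 15 * y + 15)
      <= quintic_weight v * (2 * y ^ 2 + 15 * y + 15))
      by (apply Rmult_le_compat_r; nra).
    nra. }
  destruct (Rle_dec v (13 / 10)) as [H2|H2].
  { assert (Hb : sinh v <= (3.694 - / 3.694) / 2)
      by (apply (sinh_le_centesimal 130); [simpl; lra | lra]).
    assert (Hyb : y <= 3) by (unfold y; nra).
    apply Rle_trans with (2 := arc_bound_slope_ge (11 / 10) v ltac:(lra)).
    unfold quintic_weight, quintic_weight'; fold y; nra. }
  destruct (Rle_dec v (14 / 10)) as [H3|H3].
  { assert (Hb : sinh v <= (4.084 - / 4.084) / 2)
      by (apply (sinh_le_centesimal 140); [simpl; lra | lra]).
    assert (Hyb : y <= 3.7) by (unfold y; nra).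
    apply Rle_trans with (2 := arc_bound_slope_ge (13 / 10) v ltac:(lra)).
    unfold quintic_weight, quintic_weight'; fold y; nra. }
  apply Rle_trans with (2 := arc_bound_slope_ge (14 / 10) v ltac:(lra)).
  unfold quintic_weight, quintic_weight'; fold y.
  (* The coefficients are rounded down to four decimals; the rounded quadratic still has negative
     discriminant. *)
  match goal with |- 0 <= ?e =>
    replace e with (14025 / 10000 + (- (5796 / 10000)) * y + 605 / 10000 * y ^ 2
    + (e - (14025 / 10000 + (- (5796 / 10000)) * y + 605 / 10000 * y ^ 2))) by ring end.
  apply Rplus_le_le_0_compat; [apply quadratic_nonneg; lra | nra].
Qed.

(** Halving the argument symmetrises the formula: exp (2v) - 1 = 2 exp v sinh v, and the powers of
    exp v cancel. *)
Lemma phi4_sinh v : 0 < v ->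
  phi4 (2 * v) =
    (v * cosh v * (sinh v ^ 2 + 3) - sinh v * (2 * sinh v ^ 2 + 3)) / (2 * sinh v ^ 5).
Proof.
  intros Hv; pose proof (exp_gt_one v Hv).
  unfold phi4, sinh, cosh; rewrite exp_Ropp.
  replace (exp (2 * v)) with (exp v ^ 2)
    by (simpl; rewrite Rmult_1_r, <- exp_plus; f_equal; ring).
  field; split; nra.
Qed.

Lemma phi4_le_bes u : 0 < u -> phi4 u <= bes 5 u.
Proof.
  intros Hu; set (v := u / 2).
  assert (Hv : 0 < v) by (unfold v; lra).
  replace u with (2 * v) by (unfold v; field).
  apply Rle_trans with (quintic_weight v / 2).
  2: { apply Rle_trans with (2 := bes_ge_partial_sum 5 3 (2 * v) ltac:(lra)).
       unfold quintic_weight, bes_coef; cbn -[INR fact Nat.mul].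
       rewrite !fact_simpl, !mult_INR; simpl; lra. }
  pose proof (sinh_pos v Hv) as Hs; pose proof (cosh_pos v) as Hc.
  assert (Hb : 0 <= arc_bound v - v).
  { destruct (increment_as_derivative (fun v => arc_bound v - v)
      (fun v => sinh v ^ 4 * arc_bound_slope v / (cosh v * (sinh v ^ 2 + 3)) ^ 2)
      0 v Hv) as [c [Hc1 Hc2]].
    - intros x _; apply is_derive_arc_bound.
    - replace (arc_bound 0) with 0 in Hc2.
      2: { unfold arc_bound; rewrite sinh_0; field.
           apply Rgt_not_eq, cosh_pos. }
      pose proof (arc_bound_slope_nonneg c ltac:(lra)) as Hsl.
      pose proof (cosh_pos c); pose proof (sinh_pos c ltac:(lra)).
      replace (arc_bound v - v) with (arc_bound v - v - (0 - 0)) by ring.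
      rewrite Hc2; apply Rmult_le_pos; [|lra].
      apply Rdiv_le_0_compat.
      + apply Rmult_le_pos; [apply pow_le; lra | easy].
      + apply pow_lt, Rmult_lt_0_compat; [easy|].
        pose proof (pow2_ge_0 (sinh c)); lra. }
  assert (Hb' : v * (cosh v * (sinh v ^ 2 + 3))
    <= quintic_weight v * sinh v ^ 5 + 2 * sinh v ^ 3 + 3 * sinh v).
  { apply Rle_div_r; [|unfold arc_bound in Hb; lra].
    apply Rmult_lt_0_compat; [easy|]; pose proof (pow2_ge_0 (sinh v)); lra. }
  pose proof (pow_lt (sinh v) 5 Hs).
  rewrite phi4_sinh by easy.
  apply Rle_div_l; [lra|].
  lra.
Qed.

(** * The inequality between [bes k] and the derivatives of [phi] *)

(** For k = 1, 2, 3 the bounds on phi, phi', phi'' are exactly the partial sums of b_k of degree 2,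
    1, 0. *)
Lemma bessel_ge_Derive_n_phi k u : (1 <= k <= 5)%nat -> 0 < u ->
  Derive_n phi (k - 1) u <= bes k u.
Proof.
  intros Hk Hu.
  assert (Hc : (k = 1 \/ k = 2 \/ k = 3 \/ k = 4 \/ k = 5)%nat) by lia.
  destruct Hc as [->|[->|[->|[->| ->]]]]; simpl (_ - _)%nat.
  - apply Rle_trans with (2 := bes_ge_partial_sum 1 2 u ltac:(lra)).
    simpl Derive_n; apply Rle_trans with (1 := Rlt_le _ _ (phi_lt u Hu)).
    unfold bes_coef; simpl; lra.
  - rewrite Derive_n_phi_1 by easy.
    apply Rle_trans with (2 := bes_ge_partial_sum 2 1 u ltac:(lra)).
    apply Rle_trans with (1 := Rlt_le _ _ (phi1_lt_affine u Hu)).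
    unfold bes_coef; simpl; lra.
  - rewrite Derive_n_phi_2 by easy.
    apply Rle_trans with (2 := bes_ge_0th 3 u ltac:(lra)).
    apply Rle_trans with (1 := Rlt_le _ _ (phi2_lt u Hu)).
    simpl; lra.
  - rewrite Derive_n_phi_3 by easy.
    pose proof (phi3_neg u Hu); pose proof (bes_pos 4 u ltac:(lra)); lra.
  - rewrite Derive_n_phi_4 by easy; now apply phi4_le_bes.
Qed.

(** * The reciprocal of [G] and its derivatives *)

Definition G_inv (beta u : R) : R := bes 2 (beta * u) / phi1 u.

(** The function F of the outline: the derivative of [G_inv] multiplied by [phi1 u ^ 2]. *)
Definition G_inv_slope (beta u : R) : R :=
  beta * bes 3 (beta * u) * phi1 u - phi2 u * bes 2 (beta * u).

(** For order 2 the power in front of [bes] is beta u itself, which cancels the numerator of [G]. *)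
Lemma G_eq_inv beta u : 0 < beta -> 0 < u -> G beta u = / G_inv beta u.
Proof.
  intros Hb Hu; assert (Hx : 0 < beta * u) by now apply Rmult_lt_0_compat.
  unfold G, G_inv.
  pose proof (BesselI_nat 2 (beta * u) Hx) as HB.
  change (INR 2) with 2 in HB; rewrite HB; clear HB.
  replace (2 / 2) with 1 by field; rewrite Rpower_1 by easy.
  rewrite (is_derive_unique _ _ _ (is_derive_phi u Hu)).
  pose proof (bes_pos 2 (beta * u) ltac:(lra)); pose proof (phi1_gt u Hu).
  field; lra.
Qed.

Lemma G_inv_pos beta u : 0 < beta -> 0 < u -> 0 < G_inv beta u.
Proof.
  intros Hb Hu; apply Rdiv_lt_0_compat.
  - apply bes_pos; apply Rlt_le, Rmult_lt_0_compat; easy.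
  - pose proof (phi1_gt u Hu); lra.
Qed.

Lemma is_derive_bes_scal k beta u :
  is_derive (fun u => bes k (beta * u)) u (beta * bes (S k) (beta * u)).
Proof.
  apply (is_derive_comp (bes k) (fun u => beta * u)).
  - apply is_derive_bes.
  - auto_derive; [easy | ring].
Qed.

Lemma is_derive_G_inv beta u : 0 < u ->
  is_derive (G_inv beta) u (G_inv_slope beta u / phi1 u ^ 2).
Proof.
  intros Hu; pose proof (phi1_gt u Hu).
  unfold G_inv, G_inv_slope.
  replace (_ / phi1 u ^ 2) with
    ((beta * bes 3 (beta * u) * phi1 u - bes 2 (beta * u) * phi2 u) / phi1 u ^ 2)
    by (field; lra).
  apply is_derive_div with (f := fun u => bes 2 (beta * u));
    [apply is_derive_bes_scal | now apply is_derive_phi1 | lra].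
Qed.

(** The two cross terms [beta * bes 3 (beta * u) * phi2 u] cancel. *)
Lemma is_derive_G_inv_slope beta u : 0 < u ->
  is_derive (G_inv_slope beta) u
    (beta ^ 2 * bes 4 (beta * u) * phi1 u - phi3 u * bes 2 (beta * u)).
Proof.
  intros Hu; unfold G_inv_slope.
  pose proof (is_derive_bes_scal 3 beta u) as H3.
  pose proof (is_derive_bes_scal 2 beta u) as H2.
  pose proof (is_derive_phi1 u Hu) as Hp1; pose proof (is_derive_phi2 u Hu) as Hp2.
  pose proof (is_derive_mult _ _ _ _ _ (is_derive_scal _ _ beta _ H3) Hp1 Rmult_comm) as Hl.
  pose proof (is_derive_mult _ _ _ _ _ Hp2 H2 Rmult_comm) as Hr.
  pose proof (is_derive_minus _ _ _ _ _ Hl Hr) as H.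
  unfold minus, plus, opp, mult in H; simpl in H.
  evar_last; [exact H | simpl; ring].
Qed.

(* The derivative is positive for every [beta] because [phi''' < 0]; hence the
   sign of [G_inv'] changes at most once, from negative to positive. *)
Lemma G_inv_slope_increasing beta u v : 0 < beta -> 0 < u -> u < v ->
  G_inv_slope beta u < G_inv_slope beta v.
Proof.
  intros Hb Hu Huv.
  destruct (increment_as_derivative (G_inv_slope beta)
    (fun u => beta ^ 2 * bes 4 (beta * u) * phi1 u - phi3 u * bes 2 (beta * u))
    u v Huv) as [c [Hc E]].
  - intros x Hx; apply is_derive_G_inv_slope; lra.
  - assert (Hx : 0 < beta * c) by (apply Rmult_lt_0_compat; lra).
    pose proof (bes_pos 4 (beta * c) ltac:(lra)); pose proof (bes_pos 2 (beta * c) ltac:(lra)).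
    pose proof (phi1_gt c ltac:(lra)); pose proof (phi3_neg c ltac:(lra)).
    assert (0 < beta ^ 2 * bes 4 (beta * c) * phi1 c)
      by (apply Rmult_lt_0_compat; [apply Rmult_lt_0_compat; [apply pow_lt|]|]; lra).
    assert (0 < - phi3 c * bes 2 (beta * c)) by (apply Rmult_lt_0_compat; lra).
    assert (0 < (beta ^ 2 * bes 4 (beta * c) * phi1 c - phi3 c * bes 2 (beta * c)) * (v - u))
      by (apply Rmult_lt_0_compat; lra).
    lra.
Qed.

(** * Sign of [G_inv_slope] and monotonicity for [beta] at least 1 *)

Lemma lt_near_0 (f : R -> R) (l : R) : continuous f 0 -> f 0 < l ->
  exists d, 0 < d /\ forall u, 0 < u < d -> f u < l.
Proof.
  intros Hc H0.
  destruct (Hc (fun y => y < l)) as [d Hd].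
  - apply (open_lt l); exact H0.
  - exists d; split; [apply cond_pos|].
    intros u Hu; apply Hd.
    unfold ball; simpl; unfold AbsRing_ball, abs, minus, plus, opp; simpl.
    rewrite Ropp_0, Rplus_0_r, Rabs_pos_eq; lra.
Qed.

Lemma continuous_bes_scal k beta u : continuous (fun u => bes k (beta * u)) u.
Proof.
  apply @ex_derive_continuous; eexists; apply is_derive_bes_scal.
Qed.

(** As F increases, F(u) <= 0 would give F(s) < m < 0 for s < u/2, where m = F(u/2). But F(s) >=
    1/12 - b_2(beta s) / 6, which tends to 0 with s. *)
Lemma G_inv_slope_pos beta u : 1 <= beta -> 0 < u -> 0 < G_inv_slope beta u.
Proof.
  intros Hb Hu.
  set (m := G_inv_slope beta (u / 2)).
  assert (Hm : m < G_inv_slope beta u)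
    by (apply G_inv_slope_increasing; lra).
  destruct (Rle_lt_dec (G_inv_slope beta u) 0) as [Hn|]; [exfalso|easy].
  (* The threshold exceeds b_2(0) = 1/2 because m < 0, and b_2(beta s) below it forces F(s) > m. *)
  destruct (lt_near_0 (fun s => bes 2 (beta * s)) (1 / 2 - 6 * m)) as [d [Hd H]].
  - apply continuous_bes_scal.
  - rewrite Rmult_0_r, bes_at_0; simpl; lra.
  - set (s := Rmin (d / 2) (u / 4)).
    assert (Hs : 0 < s /\ s < d /\ s < u / 2).
    { unfold s; pose proof (Rmin_l (d / 2) (u / 4)); pose proof (Rmin_r (d / 2) (u / 4)).
      split; [apply Rmin_glb_lt|]; lra. }
    assert (Hms : G_inv_slope beta s < m)
      by (apply G_inv_slope_increasing; lra).
    specialize (H s ltac:(lra)); unfold G_inv_slope in Hms.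
    assert (Hx : 0 <= beta * s) by (apply Rmult_le_pos; lra).
    pose proof (bes_pos 2 (beta * s) Hx) as H2.
    pose proof (bes_ge_0th 3 (beta * s) Hx) as H3; simpl in H3.
    pose proof (phi1_gt s ltac:(lra)); pose proof (phi2_lt s ltac:(lra)) as Hp2.
    assert (1 * (1 / 6) <= beta * bes 3 (beta * s)) by (apply Rmult_le_compat; lra).
    assert (1 * (1 / 6) * (1 / 2) <= beta * bes 3 (beta * s) * phi1 s)
      by (apply Rmult_le_compat; lra).
    assert (phi2 s * bes 2 (beta * s) <= 1 / 6 * bes 2 (beta * s))
      by (apply Rmult_le_compat_r; lra).
    lra.
Qed.

Lemma G_inv_lt_of_slope_pos beta u v : 0 < u -> u < v ->
  (forall x, u < x -> 0 < G_inv_slope beta x) -> G_inv beta u < G_inv beta v.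
Proof.
  intros Hu Huv Hs.
  destruct (increment_as_derivative (G_inv beta)
    (fun u => G_inv_slope beta u / phi1 u ^ 2) u v Huv) as [c [Hc E]].
  - intros x Hx; apply is_derive_G_inv; lra.
  - pose proof (phi1_gt c ltac:(lra)).
    assert (0 < G_inv_slope beta c / phi1 c ^ 2 * (v - u)); [|lra].
    apply Rmult_lt_0_compat; [|lra].
    apply Rdiv_lt_0_compat; [apply Hs; lra | apply pow_lt; lra].
Qed.

Lemma G_decreasing beta : 1 <= beta -> decreasing_on_pos (G beta).
Proof.
  intros Hb x y Hx Hxy.
  rewrite !G_eq_inv by lra.
  apply Rinv_lt_contravar.
  - apply Rmult_lt_0_compat; apply G_inv_pos; lra.
  - apply G_inv_lt_of_slope_pos; [easy..|].
    intros; apply G_inv_slope_pos; lra.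
Qed.

(** * Convexity of the reciprocal *)

(** The mean value theorem on either side of the intermediate point z compares the two chord
    slopes. *)
Lemma convex_of_derive_nondecreasing (f f' : R -> R) :
  (forall u, 0 < u -> is_derive f u (f' u)) ->
  (forall u v, 0 < u -> u <= v -> f' u <= f' v) ->
  convex_on_pos f.
Proof.
  intros Hd Hm.
  assert (Hlt : forall x y t, 0 < x -> x < y -> 0 < t < 1 ->
    f (t * x + (1 - t) * y) <= t * f x + (1 - t) * f y).
  { intros x y t Hx Hxy Ht; set (z := t * x + (1 - t) * y).
    assert (Hz : x < z < y) by (unfold z; nra).
    destruct (increment_as_derivative f f' x z) as [a [Ha Ea]];
      [lra | intros; apply Hd; lra|].
    destruct (increment_as_derivative f f' z y) as [b [Hb Eb]];
      [lra | intros; apply Hd; lra|].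
    pose proof (Hm a b ltac:(lra) ltac:(lra)) as Hab.
    assert (E1 : z - x = (1 - t) * (y - x)) by (unfold z; ring).
    assert (E2 : y - z = t * (y - x)) by (unfold z; ring).
    rewrite E1 in Ea; rewrite E2 in Eb.
    assert (0 <= t * (1 - t) * (y - x) * (f' b - f' a))
      by (repeat apply Rmult_le_pos; lra).
    assert (t * f x + (1 - t) * f y - f z
      = t * (1 - t) * (y - x) * (f' b - f' a)); [|lra].
    replace (t * f x + (1 - t) * f y - f z)
      with ((1 - t) * (f y - f z) - t * (f z - f x)) by ring.
    rewrite Ea, Eb; ring. }
  intros x y t Hx Hy Ht.
  destruct (Req_dec t 0) as [->|Ht0].
  { replace (0 * x + (1 - 0) * y) with y by ring; lra. }
  destruct (Req_dec t 1) as [->|Ht1].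
  { replace (1 * x + (1 - 1) * y) with x by ring; lra. }
  destruct (Rtotal_order x y) as [Hxy|[<-|Hxy]].
  - apply Hlt; lra.
  - replace (t * x + (1 - t) * x) with x by ring; lra.
  - pose proof (Hlt y x (1 - t) Hy Hxy ltac:(lra)) as H.
    replace (t * x + (1 - t) * y) with ((1 - t) * y + (1 - (1 - t)) * x) by ring.
    lra.
Qed.

Lemma G_inv_convex beta : 0 < beta -> convex_on_pos (G_inv beta).
Proof.
  intros Hb.
  apply convex_of_derive_nondecreasing with
    (f' := fun u => G_inv_slope beta u / phi1 u ^ 2).
  { intros u Hu; now apply is_derive_G_inv. }
  intros u v Hu [Huv|<-]; [|lra].
  destruct (increment_as_derivative (fun u => G_inv_slope beta u / phi1 u ^ 2)
    (fun u => ((beta ^ 2 * bes 4 (beta * u) * phi1 u - phi3 u * bes 2 (beta * u)) * phi1 u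
       - 2 * G_inv_slope beta u * phi2 u) / phi1 u ^ 3) u v Huv) as [c [Hc E]].
  - intros x Hx.
    pose proof (phi1_gt x ltac:(lra)).
    evar_last.
    + apply @is_derive_div.
      * apply is_derive_G_inv_slope; lra.
      * apply is_derive_pow, is_derive_phi1; lra.
      * apply pow_nonzero; lra.
    + simpl; field; lra.
  - assert (Hx : 0 <= beta * c) by (apply Rmult_le_pos; lra).
    (* The numerator of the second derivative is this form at X = beta phi', Y = phi'', plus the
       nonnegative term - phi''' b_2 phi'. *)
    pose proof (bes_quadratic_form_nonneg (beta * c) (beta * phi1 c) (phi2 c) Hx) as Hq.
    pose proof (phi1_gt c ltac:(lra)); pose proof (phi3_neg c ltac:(lra)).
    pose proof (bes_pos 2 (beta * c) Hx).
    assert (0 <= - phi3 c * bes 2 (beta * c) * phi1 c)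
      by (apply Rmult_le_pos; [apply Rmult_le_pos|]; lra).
    assert (0 <= ((beta ^ 2 * bes 4 (beta * c) * phi1 c - phi3 c * bes 2 (beta * c)) * phi1 c
       - 2 * G_inv_slope beta c * phi2 c) / phi1 c ^ 3 * (v - u)); [|lra].
    apply Rmult_le_pos; [|lra].
    apply Rdiv_le_0_compat; [|apply pow_lt; lra].
    unfold G_inv_slope; lra.
Qed.

(** * Sign change of the slope and unimodality for [beta] below 1 *)

(** F is bounded above by a function continuous at 0, built from the bounds on phi' and phi'', whose
    value there is (beta - 1) / 12 < 0. *)
Lemma G_inv_slope_neg_near_0 beta : 0 < beta < 1 ->
  exists u, 0 < u /\ G_inv_slope beta u < 0.
Proof.
  intros Hb.
  destruct (lt_near_0 (fun s => beta * bes 3 (beta * s) * (1 / 2 + s / 6)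
    - / (6 * exp s ^ 2) * (1 / 2)) 0) as [d [Hd H]].
  - assert (Hc := is_derive_bes_scal 3 beta 0).
    pose proof (exp_pos 0).
    apply @ex_derive_continuous.
    apply (ex_derive_minus (fun s => beta * bes 3 (beta * s) * (1 / 2 + s / 6))).
    + apply ex_derive_mult; [|auto_derive; easy].
      apply ex_derive_scal; eexists; exact Hc.
    + auto_derive; apply Rgt_not_eq; nra.
  - rewrite Rmult_0_r, bes_at_0, exp_0; simpl; lra.
  - exists (d / 2); split; [lra|].
    specialize (H (d / 2) ltac:(lra)); set (s := d / 2) in *.
    assert (Hs : 0 < s) by (unfold s; lra).
    assert (Hx : 0 <= beta * s) by (apply Rmult_le_pos; lra).
    pose proof (bes_pos 3 (beta * s) Hx).
    pose proof (bes_ge_0th 2 (beta * s) Hx) as H2; simpl in H2.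
    pose proof (phi1_lt_affine s Hs); pose proof (phi2_gt s Hs).
    assert (0 < / (6 * exp s ^ 2))
      by (apply Rinv_0_lt_compat; pose proof (pow_lt (exp s) 2 (exp_pos s)); lra).
    assert (beta * bes 3 (beta * s) * phi1 s
      <= beta * bes 3 (beta * s) * (1 / 2 + s / 6))
      by (apply Rmult_le_compat_l; [apply Rmult_le_pos|]; lra).
    assert (/ (6 * exp s ^ 2) * (1 / 2) <= phi2 s * bes 2 (beta * s))
      by (apply Rmult_le_compat; lra).
    unfold G_inv_slope; lra.
Qed.

(* Otherwise [G_inv] would be bounded, whereas [G_inv u >= 1/2 + beta u / 6]. *)
Lemma G_inv_slope_pos_somewhere beta : 0 < beta ->
  exists u, 0 < u /\ 0 < G_inv_slope beta u.
Proof.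
  intros Hb.
  set (M := G_inv beta 1).
  assert (HM : 0 < M) by (apply G_inv_pos; lra).
  (* With this v, b_2(beta v) >= 1/2 + beta/6 + M > M, while phi'(v) < 1. *)
  set (v := 1 + 6 * M / beta).
  assert (Hv : 1 < v).
  { assert (0 < 6 * M / beta) by (apply Rdiv_lt_0_compat; lra). unfold v; lra. }
  destruct (increment_as_derivative (G_inv beta)
    (fun u => G_inv_slope beta u / phi1 u ^ 2) 1 v Hv) as [c [Hc E]].
  { intros x Hx; apply is_derive_G_inv; lra. }
  exists c; split; [lra|].
  pose proof (phi1_gt c ltac:(lra)).
  assert (Hgrow : M < G_inv beta v).
  { assert (Hx : 0 <= beta * v) by (apply Rmult_le_pos; lra).
    pose proof (bes_ge_partial_sum 2 1 (beta * v) Hx) as H2.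
    unfold bes_coef in H2; simpl in H2.
    pose proof (phi1_gt v ltac:(lra)); pose proof (phi1_lt_1 v ltac:(lra)).
    assert (Ebv : beta * v = beta + 6 * M) by (unfold v; field; lra).
    assert (M * phi1 v < M * 1) by (apply Rmult_lt_compat_l; lra).
    unfold G_inv; apply -> Rlt_div_r; lra. }
  fold M in E.
  apply Rnot_le_lt; intros Hn.
  assert (0 <= - (G_inv_slope beta c / phi1 c ^ 2 * (v - 1))); [|lra].
  replace (- (G_inv_slope beta c / phi1 c ^ 2 * (v - 1)))
    with ((- G_inv_slope beta c) / phi1 c ^ 2 * (v - 1)) by (field; lra).
  apply Rmult_le_pos; [|lra].
  apply Rdiv_le_0_compat; [lra | apply pow_lt; lra].
Qed.

Lemma G_inv_slope_zero beta : 0 < beta < 1 ->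
  exists u, 0 < u /\ G_inv_slope beta u = 0.
Proof.
  intros Hb.
  destruct (G_inv_slope_neg_near_0 beta Hb) as [a [Ha Hna]].
  destruct (G_inv_slope_pos_somewhere beta ltac:(lra)) as [b [Hb0 Hpb]].
  assert (Hab : a < b).
  { apply Rnot_le_lt; intros [Hba|<-]; [|lra].
    pose proof (G_inv_slope_increasing beta b a ltac:(lra) Hb0 Hba); lra. }
  destruct (IVT_interv (G_inv_slope beta) a b) as [z [Hz Ez]]; [|easy..|].
  - intros x Hx.
    apply derivable_continuous_pt; eexists; apply is_derive_Reals.
    apply is_derive_G_inv_slope; lra.
  - exists z; split; [lra | easy].
Qed.

(** F is negative before its zero z and positive after it, so [G_inv] has a strict global minimum at
    z, which is the only maximum point of [G]. *)
Lemma G_unimodal beta : 0 < beta < 1 -> unimodal_on_pos (G beta).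
Proof.
  intros Hb.
  destruct (G_inv_slope_zero beta Hb) as [z [Hz Ez]].
  assert (Hmin : forall y, 0 < y -> y <> z -> G_inv beta z < G_inv beta y).
  { intros y Hy Hne.
    destruct (Rtotal_order y z) as [Hyz|[->|Hyz]]; [|easy|].
    - destruct (increment_as_derivative (G_inv beta)
        (fun u => G_inv_slope beta u / phi1 u ^ 2) y z Hyz) as [c [Hc E]].
      + intros x Hx; apply is_derive_G_inv; lra.
      + pose proof (phi1_gt c ltac:(lra)).
        pose proof (G_inv_slope_increasing beta c z ltac:(lra) ltac:(lra) ltac:(lra)).
        assert (0 < (- G_inv_slope beta c) / phi1 c ^ 2 * (z - y)).
        { apply Rmult_lt_0_compat; [|lra].
          apply Rdiv_lt_0_compat; [lra | apply pow_lt; lra]. }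
        replace ((- G_inv_slope beta c) / phi1 c ^ 2 * (z - y))
          with (- (G_inv_slope beta c / phi1 c ^ 2 * (z - y))) in H1 by (field; lra).
        lra.
    - apply G_inv_lt_of_slope_pos; [easy..|].
      intros x Hx.
      pose proof (G_inv_slope_increasing beta z x ltac:(lra) Hz Hx); lra. }
  assert (Hmax : forall y, 0 < y -> y <> z -> G beta y < G beta z).
  { intros y Hy Hne; rewrite !G_eq_inv by lra.
    apply Rinv_lt_contravar; [|now apply Hmin].
    apply Rmult_lt_0_compat; apply G_inv_pos; lra. }
  exists z; split.
  - split; [easy|]; intros y Hy.
    destruct (Req_dec y z) as [->|Hne]; [lra | now apply Rlt_le, Hmax].
  - intros x [Hx Hxmax].
    destruct (Req_dec x z) as [->|Hne]; [easy|].
    pose proof (Hmax x Hx Hne); pose proof (Hxmax z Hz); lra.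
Qed.

Theorem theorem1p2 :
  (forall k : nat, (1 <= k <= 5)%nat ->
    forall u : R, 0 < u ->
      BesselI (INR k) (2 * sqrt u) / Rpower u (INR k / 2)
        >= Derive_n phi (k - 1) u)
  /\
  (forall beta : R, 0 < beta ->
    (1 <= beta -> decreasing_on_pos (G beta)) /\
    (beta < 1 ->
      unimodal_on_pos (G beta) /\ convex_on_pos (fun u : R => / G beta u))).
Proof.
  split.
  - intros k Hk u Hu.
    rewrite BesselI_nat by easy.
    replace (_ / _) with (bes k u)
      by (field; apply Rgt_not_eq, exp_pos).
    now apply Rle_ge, bessel_ge_Derive_n_phi.
  - intros beta Hb; split; [exact (G_decreasing beta)|].
    intros Hb1; split; [now apply G_unimodal|].
    intros x y t Hx Hy Ht.
    (* [G_eq_inv] applies at positive points, so the convex combination must be shown positive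
       first. *)
    assert (Hz : 0 < t * x + (1 - t) * y).
    { destruct (Req_dec t 0) as [->|Ht0]; [lra|].
      assert (0 < t * x) by (apply Rmult_lt_0_compat; lra).
      assert (0 <= (1 - t) * y) by (apply Rmult_le_pos; lra); lra. }
    rewrite !G_eq_inv, !Rinv_inv by easy.
    now apply G_inv_convex.
Qed.
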